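(* Let $Q$ be the quasi-interpolant defined for $f\in C(I)$ by $$Qf=\sum_{i=0}^{n}\big[f(\xi_i)B_{2i}+f(\eta_i)B_{2i+1}\big].$$ Then $Q$ is exact on the space $\mathbb P_1$ of affine polynomials (i.e. $Qp=p$ for all $p\in\mathbb P_1$), $\|Q\|_\infty=1$, and $Q$ preserves the monotonicity and the convexity of $f$ (if $f$ is increasing, resp. decreasing, resp. convex on $I$, then so is $Qf$).
   Context: Setting. Let $n\ge 1$, $I=[a,b]$, $X=\{a=x_0<x_1<\dots<x_n=b\}$ a partition of $I$, $I_i=[x_{i-1},x_i]$, $h_i=x_i-x_{i-1}$, $m_i=\frac12(x_{i-1}+x_i)$ for $1\le i\le n$. Let $\beta=(\beta_1,\dots,\beta_n)$ with $\beta_i\in[-1,0[$ and $\theta_i=\frac12\frac{\beta_i}{\beta_i-1}\in\,]0,\frac14]$ (equivalently $\beta_i=\frac{-2\theta_i}{1-2\theta_i}$). The space $V(\beta_i)$ (generated by the Merrien subdivision algorithm) is the set of $C^1$ functions $f$ on $I_i$ such that for every dyadic subinterval $[u,v]$ of $I_i$ (i.e. every interval obtained from $I_i$ by repeated bisection, including $I_i$ itself), with $m=\frac12(u+v)$ and $h=v-u$, $$f(m)=\tfrac12\big(f(u)+f(v)-\theta_i h\,(f'(v)-f'(u))\big),\qquad f'(m)=\frac{1}{1-2\theta_i}\Big(\frac{f(v)-f(u)}{h}-2\theta_i\,\frac{f'(u)+f'(v)}{2}\Big).$$ It is known that for any prescribed values of $f,f'$ at the two endpoints of $I_i$ there is exactly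 one such $f$; so $\dim V(\beta_i)=4$. $GS_2(\beta)=GS_2(I,X,\beta)$ is the space of all $g\in C^1(I)$ with $g|_{I_i}\in V(\beta_i)$ for all $1\le i\le n$ (generalized quadratic splines); it has dimension $2n+2$. The list of B-coefficients of $f\in V(\beta_i)$ on $I_i$ is $[\,f(x_{i-1}),\ f(x_{i-1})+\theta_ih_if'(x_{i-1}),\ f(x_i)-\theta_ih_if'(x_i),\ f(x_i)\,]$; it determines $f$ uniquely. For $1\le i\le n-1$ let $\omega_i=\frac{\theta_{i+1}h_{i+1}}{\theta_ih_i+\theta_{i+1}h_{i+1}}$. The generalized quadratic B-splines are the functions on $I$ defined by their B-coefficients as follows (all B-coefficients on subintervals not mentioned are zero). For $1\le i\le n-1$: $B_{2i}$ has lists $[0,0,1,\omega_i]$ on $I_i$ and $[\omega_i,0,0,0]$ on $I_{i+1}$; $B_{2i+1}$ has lists $[0,0,0,1-\omega_i]$ on $I_i$ and $[1-\omega_i,1,0,0]$ on $I_{i+1}$. At the ends: $B_0$ has list $[1,0,0,0]$ on $I_1$; $B_1$ has list $[0,1,0,0]$ on $I_1$; $B_{2n}$ has list $[0,0,1,0]$ on $I_n$; $B_{2n+1}$ has list $[0,0,0,1]$ on $I_n$. The family $\{B_k\}_{0\le k\le 2n+1}$ is a basis of $GS_2(\beta)$. Nodes: $\xi_0=x_0$, $\xi_i=x_i-\theta_ih_i$ for $1\le i\le n$, $\eta_i=x_i+\theta_{i+1}h_{i+1}$ for $0\le i\le n-1$, $\eta_n=x_n$. The norm $\|Q\|_\infty$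 is the operator norm of $Q:C(I)\to C(I)$ for the uniform norm. Increasing/decreasing is understood in the weak sense. *)

(* Defs.v *)
(* MathComp-Analysis: functions on a compact interval are maps R -> R, of which
   only the values on the interval matter. *)
From HB Require Import structures.
From mathcomp Require Export all_boot all_order all_algebra.
From mathcomp Require Export all_classical all_reals all_analysis.
Export Order.TTheory GRing.Theory Num.Theory numFieldNormedType.Exports.

Set Implicit Arguments.
Unset Strict Implicit.
Unset Printing Implicit Defensive.

Local Open Scope classical_set_scope.
Local Open Scope ring_scope.

(* The difference quotient is only sampled inside [u, v], so that this is the
   two-sided derivative in the interior and the one-sided one at u and v. *)
Definition diff_quot (R : realType) (f : R -> R) (s : R) : R -> R :=
  fun t => (f t - f s) / (t - s).

Definition derivable_on (R : realType) (u v : R) (f : R -> R) (s : R) : Prop :=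
  cvg (diff_quot f s @ within `[u, v] s^').

Definition derive_on (R : realType) (u v : R) (f : R -> R) (s : R) : R :=
  lim (diff_quot f s @ within `[u, v] s^').

Definition C1_on (R : realType) (u v : R) (f : R -> R) : Prop :=
  (forall s, s \in `[u, v] -> derivable_on u v f s) /\
  {within `[u, v], continuous (derive_on u v f)}.

Inductive dyadic_sub (R : realType) (u v : R) : R -> R -> Prop :=
| dyadic_whole : dyadic_sub u v u v
| dyadic_left s t : dyadic_sub u v s t -> dyadic_sub u v s ((s + t) / 2)
| dyadic_right s t : dyadic_sub u v s t -> dyadic_sub u v ((s + t) / 2) t.

Definition theta_of (R : realType) (beta : R) : R := 2^-1 * (beta / (beta - 1)).

(* The space V(beta) on [u, v], with theta = theta_of beta. *)
Definition merrien (R : realType) (beta u v : R) (f : R -> R) : Prop :=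
  let th := theta_of beta in
  let f' := derive_on u v f in
  C1_on u v f /\
  forall s t, dyadic_sub u v s t ->
    let m := (s + t) / 2 in
    let h := t - s in
    f m = 2^-1 * (f s + f t - th * h * (f' t - f' s)) /\
    f' m = (1 - 2 * th)^-1 * ((f t - f s) / h - 2 * th * ((f' s + f' t) / 2)).

Definition Bcoefs (R : realType) (beta u v : R) (f : R -> R) : seq R :=
  let th := theta_of beta in
  let h := v - u in
  let f' := derive_on u v f in
  [:: f u; f u + th * h * f' u; f v - th * h * f' v; f v].

(* In what follows the knots are x 0, ..., x n and beta i belongs to the i-th
   subinterval [x i.-1, x i], 1 <= i <= n; other values are irrelevant. *)

Definition GS2 (R : realType) (n : nat) (x beta : nat -> R) (g : R -> R) : Prop :=
  C1_on (x 0%N) (x n) g /\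
  forall i, (1 <= i <= n)%N -> merrien (beta i) (x i.-1) (x i) g.

(* theta_i * h_i *)
Definition thetah (R : realType) (x beta : nat -> R) (i : nat) : R :=
  theta_of (beta i) * (x i - x i.-1).

Definition omega (R : realType) (x beta : nat -> R) (i : nat) : R :=
  thetah x beta i.+1 / (thetah x beta i + thetah x beta i.+1).

(* List of B-coefficients on the j-th subinterval of B_{2i}, then of B_{2i+1}. *)
Definition coefs_even (R : realType) (n : nat) (x beta : nat -> R)
    (i j : nat) : seq R :=
  let w := omega x beta i in
  if i == 0%N then if j == 1%N then [:: 1; 0; 0; 0] else [:: 0; 0; 0; 0]
  else if i == n then if j == n then [:: 0; 0; 1; 0] else [:: 0; 0; 0; 0]
  else if j == i then [:: 0; 0; 1; w]
  else if j == i.+1 then [:: w; 0; 0; 0]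
  else [:: 0; 0; 0; 0].

Definition coefs_odd (R : realType) (n : nat) (x beta : nat -> R)
    (i j : nat) : seq R :=
  let w := omega x beta i in
  if i == 0%N then if j == 1%N then [:: 0; 1; 0; 0] else [:: 0; 0; 0; 0]
  else if i == n then if j == n then [:: 0; 0; 0; 1] else [:: 0; 0; 0; 0]
  else if j == i then [:: 0; 0; 0; 1 - w]
  else if j == i.+1 then [:: 1 - w; 1; 0; 0]
  else [:: 0; 0; 0; 0].

Definition has_coefs (R : realType) (n : nat) (x beta : nat -> R)
    (g : R -> R) (c : nat -> seq R) : Prop :=
  GS2 n x beta g /\
  forall j, (1 <= j <= n)%N -> Bcoefs (beta j) (x j.-1) (x j) g = c j.

(* B-coefficients determine a generalized spline on [x 0, x n], so this
   determines B 0, ..., B (2n+1) there. *)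
Definition Bspline_family (R : realType) (n : nat) (x beta : nat -> R)
    (B : nat -> R -> R) : Prop :=
  forall i, (i <= n)%N ->
    has_coefs n x beta (B i.*2) (coefs_even n x beta i) /\
    has_coefs n x beta (B i.*2.+1) (coefs_odd n x beta i).

Definition xi_node (R : realType) (x beta : nat -> R) (i : nat) : R :=
  if i == 0%N then x 0%N else x i - thetah x beta i.

Definition eta_node (R : realType) (n : nat) (x beta : nat -> R) (i : nat) : R :=
  if i == n then x n else x i + thetah x beta i.+1.

Definition quasi_interp (R : realType) (n : nat) (x beta : nat -> R)
    (B : nat -> R -> R) (f : R -> R) : R -> R :=
  fun t => \sum_(i < n.+1) (f (xi_node x beta i) * B i.*2 t
                            + f (eta_node n x beta i) * B i.*2.+1 t).

(* Suprema are taken in the extended reals, where they always exist. *)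
Definition unif_norm (R : realType) (a b : R) (f : R -> R) : \bar R :=
  ereal_sup [set `|f t|%:E | t in `[a, b]].

Definition op_norm (R : realType) (a b : R) (Q : (R -> R) -> R -> R) : \bar R :=
  ereal_sup [set unif_norm a b (Q f) | f in
    [set f | {within `[a, b], continuous f} /\ (unif_norm a b f <= 1%:E)%E]].

(* Main.v *)
Require Import Defs.
From mathcomp Require Import ring lra.

Set Implicit Arguments.
Unset Strict Implicit.
Unset Printing Implicit Defensive.

Local Open Scope classical_set_scope.
Local Open Scope ring_scope.

(** Write g = Q f and g' for its derivative. Everything follows from three
    observations.

    - The B-coefficients of g on the subinterval [x i, x i.+1] are
      [:: V i; f (eta i); f (xi i.+1); V i.+1], where V i is a convex
      combination of f (xi i) and f (eta i)
      ([quasi_interp_coefs]). Solving for the derivatives, g' at the knot x i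
      is the divided difference of f between xi i and eta i, and g' at the
      midpoint is that between eta i and xi i.+1 ([quasi_interp_derive]). So
      the values of g' at knots and midpoints are, in order, the slopes of the
      polygon that interpolates f at all the nodes.

    - In a Merrien space the scheme closes on the derivative alone: the value
      of f' at the middle of each half of a dyadic interval is a convex
      combination of its values at the ends of that half
      ([merrien_quarter_rule]). Hence bounds on f', and the order of its values
      at the two ends and the midpoint, pass to all dyadic points by bisection
      and then to the whole interval by continuity ([quarter_rule_range],
      [quarter_rule_nondecreasing]).

    - In terms of B-coefficients, bisection is corner cutting: the
      coefficients on a half are convex combinations of those on the whole, so
      f stays between the least and the greatest of them ([merrien_range]).

    If f is affine, all the slopes are equal, so g' is constant, and g agrees
    with f at the left end of the interval. If f is increasing, the slopes are
    nonnegative, hence g' >= 0; the decreasing case is the same for - f. If f is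
    convex, the slopes increase, hence so does g'. The mean value theorem
    concludes each time. Finally, the B-coefficients of g lie between any bounds
    of f, so the norm of Q is at most 1, and Q 1 = 1 shows that it is
    attained. *)

(** * The derivative relative to a closed interval *)

(** Limits along this filter are unique, also at the end points, because the
    interval is nondegenerate. *)
Lemma within_dnbhs_itv_proper (R : realType) (u v s : R) :
  u < v -> s \in `[u, v] -> ProperFilter (within `[u, v] s^').
Proof.
move=> uv /[!in_itv]/= /andP[us sv]; split; last exact: within_filter.
rewrite /within/= /dnbhs/= /within /= => H.
have/nbhs_ballP [e/= e0 He] := H.
have [sltv|vs] := ltP s v.
  (* A point of the interval close to s, on a side where there is room. *)
  pose t := Num.min v (s + e / 2).
  have st : s < t by rewrite lt_min sltv /=; lra.
  apply: (He t); last 2 first.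
  - by rewrite gt_eqF.
  - by rewrite in_itv/= ge_min lexx (le_trans us (ltW st)).
  rewrite /ball/= ltr0_norm ?subr_lt0// opprB ltrBlDl.
  by rewrite gt_min; apply/orP; right; lra.
pose t := Num.max u (s - e / 2).
have st : t < s by rewrite gt_max (lt_le_trans uv vs)/=; lra.
apply: (He t); last 2 first.
- by rewrite lt_eqF.
- by rewrite in_itv/= le_max lexx/= (le_trans (ltW st) sv).
rewrite /ball/= gtr0_norm ?subr_gt0// ltrBlDl -ltrBlDr.
by rewrite lt_max; apply/orP; right; lra.
Qed.

Lemma derive_on_val (R : realType) (u v s l : R) (f : R -> R) :
  u < v -> s \in `[u, v] ->
  diff_quot f s @ within `[u, v] s^' --> l -> derive_on u v f s = l.
Proof.
move=> uv suv; have FF := within_dnbhs_itv_proper uv suv.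
exact: norm_cvg_lim.
Qed.

(** The quotient has a limit along a finer filter, which is still proper. At a
    knot this identifies the one-sided derivatives from the two adjacent
    subintervals with the derivative on the whole interval. *)
Lemma derive_on_sub (R : realType) (a b u v s : R) (f : R -> R) :
  a <= u -> u < v -> v <= b -> s \in `[u, v] -> derivable_on a b f s ->
  derive_on u v f s = derive_on a b f s.
Proof.
move=> au uv vb suv df; apply: derive_on_val => //.
apply: cvg_trans df; apply: cvg_app => P.
rewrite /nbhs/= /within/=; apply: (@filterS _ s^') => t /= + tuv; apply.
by move: tuv; rewrite /= !in_itv/=; lra.
Qed.

Lemma continuous_itvP (R : realType) (u v : R) (F : R -> R) :
  {within `[u, v], continuous F} <->
  (forall s, s \in `[u, v] -> F @ within `[u, v] (nbhs s) --> F s).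
Proof. exact: subspace_continuousP. Qed.

Lemma diff_quot_lin (R : realType) (a b u v s : R) (f g : R -> R) :
  derivable_on u v f s -> derivable_on u v g s ->
  diff_quot (fun t => a * f t + b * g t) s @ within `[u, v] s^' -->
    a * derive_on u v f s + b * derive_on u v g s.
Proof.
move=> df dg.
rewrite (_ : diff_quot _ s = (fun t => a * diff_quot f s t + b * diff_quot g s t)).
  by apply: cvgD; apply: cvgMr.
by apply/funext => t; rewrite /diff_quot; ring.
Qed.

Lemma derivable_on_lin (R : realType) (a b u v s : R) (f g : R -> R) :
  derivable_on u v f s -> derivable_on u v g s ->
  derivable_on u v (fun t => a * f t + b * g t) s.
Proof. by move=> df dg; apply/cvg_ex; eexists; exact: diff_quot_lin. Qed.

Lemma derive_on_lin (R : realType) (a b u v s : R) (f g : R -> R) :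
  u < v -> s \in `[u, v] -> derivable_on u v f s -> derivable_on u v g s ->
  derive_on u v (fun t => a * f t + b * g t) s =
    a * derive_on u v f s + b * derive_on u v g s.
Proof. by move=> uv suv df dg; apply: derive_on_val => //; exact: diff_quot_lin. Qed.

Lemma C1_on_lin (R : realType) (a b u v : R) (f g : R -> R) :
  u < v -> C1_on u v f -> C1_on u v g -> C1_on u v (fun t => a * f t + b * g t).
Proof.
move=> uv [df cf] [dg cg]; split=> [s suv|].
  by apply: derivable_on_lin; [exact: df|exact: dg].
apply/continuous_itvP => s suv.
have -> : derive_on u v (fun t => a * f t + b * g t) s =
    a * derive_on u v f s + b * derive_on u v g s.
  by apply: derive_on_lin => //; [exact: df|exact: dg].
apply: (cvg_trans (G := (fun t => a * derive_on u v f t + b * derive_on u v g t)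
    @ within `[u, v] (nbhs s))).
  apply: near_eq_cvg; rewrite near_withinE; apply: nearW => t /= tuv.
  by rewrite derive_on_lin//; [exact: df|exact: dg].
apply: cvgD; apply: cvgMr.
  by move/continuous_itvP: cf; apply.
by move/continuous_itvP: cg; apply.
Qed.

Lemma derivable_on_continuous (R : realType) (u v : R) (f : R -> R) :
  (forall s, s \in `[u, v] -> derivable_on u v f s) ->
  {within `[u, v], continuous f}.
Proof.
move=> df; apply/continuous_itvP => s suv.
(* This function coincides with f off s. *)
have H : (fun t => f s + (t - s) * diff_quot f s t) @ within `[u, v] s^' --> f s.
  rewrite -[X in _ --> X]addr0 -[X in _ + X](mul0r (derive_on u v f s)).
  apply: cvgD; first exact: cvg_cst.
  apply: cvgM; last exact: df.
  rewrite -(subrr s); apply: cvgB; last exact: cvg_cst.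
  apply: (@cvg_trans _ (id @ s^')); first exact: cvg_app (cvg_within _).
  exact: (cvg_within _).
apply/cvgrPdist_lt => e e0; rewrite near_withinE.
move/cvgrPdist_lt : H => /(_ e e0).
rewrite !near_withinE; apply: filterS => t /= H tuv.
have [->|ts] := eqVneq t s; first by rewrite subrr normr0.
have := H ts tuv; rewrite /diff_quot mulrC divfK ?subr_eq0//.
by rewrite addrCA subrr addr0.
Qed.

Lemma is_derive_on (R : realType) (u v s : R) (f : R -> R) :
  s \in `]u, v[ -> derivable_on u v f s -> is_derive s 1 f (derive_on u v f s).
Proof.
move=> suv df.
have H : (fun h => h^-1 *: ((f \o shift s) (h *: (1 : R)) - f s)) @ 0^' -->
    derive_on u v f s.
  apply/cvgrPdist_lt => e e0.
  move/cvgrPdist_lt : df => /(_ e e0).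
  rewrite !near_withinE => /nbhs_ballP[d /= d0 Hd].
  have [d' d'0 Hd'] : exists2 d', 0 < d' & forall t, `|t| < d' -> t + s \in `[u, v].
    move: suv; rewrite in_itv/= => /andP[us sv].
    exists (Num.min (s - u) (v - s)); first by rewrite lt_min !subr_gt0 us.
    move=> t; rewrite lt_min !ltr_norml in_itv/=; lra.
  apply/nbhs_ballP; exists (Num.min d d') => /=; first by rewrite lt_min d0.
  move=> h; rewrite /ball/= sub0r normrN lt_min => /andP[hd hd'] h0.
  have := Hd (h + s); rewrite /ball/= opprD addrCA subrr addr0 normrN => /(_ hd).
  rewrite -subr_eq0 addrK => /(_ h0 (Hd' _ hd')).
  by rewrite /diff_quot addrK /shift/= [_ *: 1]mulr1 [_ *: _]mulrC.
apply: DeriveDef; first by apply/cvg_ex; eexists; exact: H.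
exact: norm_cvg_lim H.
Qed.

(** Inside the interval [derive_on] is the ordinary derivative, so the usual
    mean value theorem applies. *)
Lemma MVT_on (R : realType) (u v s t : R) (f : R -> R) :
  (forall s, s \in `[u, v] -> derivable_on u v f s) ->
  s \in `[u, v] -> t \in `[u, v] -> s <= t ->
  exists2 c, c \in `[s, t] & f t - f s = derive_on u v f c * (t - s).
Proof.
move=> df /[!in_itv]/= /andP[us sv] /andP[ut tv] st.
apply: (@MVT_segment _ f (derive_on u v f) s t st) => [c|].
  rewrite in_itv/= => /andP[sc ct]; apply: is_derive_on.
    by rewrite in_itv/=; lra.
  by apply: df; rewrite in_itv/=; lra.
apply: continuous_subspaceW (derivable_on_continuous df).
by move=> c; rewrite /= !in_itv/=; lra.
Qed.

(** * Dyadic subdivision *)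

Lemma dyadic_itv (R : realType) (u v s t : R) : u < v -> dyadic_sub u v s t ->
  [/\ u <= s, s < t & t <= v].
Proof.
move=> uv; elim=> {s t}[|s t _ [us st tv]|s t _ [us st tv]]; split; lra.
Qed.

Lemma dyadic_trans (R : realType) (u v s t p q : R) :
  dyadic_sub u v s t -> dyadic_sub s t p q -> dyadic_sub u v p q.
Proof.
by move=> uvst; elim=> // *; [exact: dyadic_left|exact: dyadic_right].
Qed.

Lemma dyadic_small (R : realType) (u v y e : R) : u < v -> y \in `[u, v] ->
  0 < e -> exists s t, [/\ dyadic_sub u v s t, s <= y, y <= t & t - s < e].
Proof.
move=> uv /[!in_itv]/= /andP[uy yv] e0.
have [k ke] : exists k, (v - u) / 2 ^+ k < e.
  exists (Num.bound ((v - u) / e)); rewrite ltr_pdivrMr ?exprn_gt0//.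
  by rewrite mulrC -ltr_pdivrMr// upper_nthrootP.
suff [s [t [st sy yt tsE]]] : exists s t, [/\ dyadic_sub u v s t, s <= y,
    y <= t & t - s = (v - u) / 2 ^+ k].
  by exists s, t; split; rewrite ?tsE.
elim: k {ke} => [|k [s [t [st sy yt tsE]]]].
  by exists u, v; split => //; [exact: dyadic_whole|rewrite expr0 divr1].
have halve : (v - u) / 2 ^+ k.+1 = (t - s) / 2.
  by rewrite tsE exprSr invfM mulrA.
have [ym|/ltW my] := leP y ((s + t) / 2).
  exists s, ((s + t) / 2); split => //; first exact: dyadic_left.
  by rewrite halve; field.
exists ((s + t) / 2), t; split => //; first exact: dyadic_right.
by rewrite halve; field.
Qed.

(** Left ends of dyadic intervals are dense, and the bounds are closed
    conditions. *)
Lemma dyadic_range (R : realType) (u v A B : R) (F : R -> R) :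
  u < v -> {within `[u, v], continuous F} ->
  (forall s t, dyadic_sub u v s t -> A <= F s <= B) ->
  forall y, y \in `[u, v] -> A <= F y <= B.
Proof.
move=> uv /continuous_itvP cF FAB y yuv.
suff H e : 0 < e -> A <= F y + e /\ F y <= B + e.
  by apply/andP; split; apply/ler_addgt0Pr => e /H[].
move=> e0; have /cvgrPdist_lt/(_ e e0) := cF y yuv.
rewrite near_withinE => /nbhs_ballP[d /= d0 Hd].
have [s [t [st sy yt std]]] := dyadic_small uv yuv d0.
have [us ? tv] := dyadic_itv uv st.
have ys : ball y d s by rewrite /ball/= ger0_norm ?subr_ge0//; lra.
have suv : s \in `[u, v] by rewrite in_itv/=; lra.
have := Hd s ys suv; have := FAB s t st.
by rewrite ltr_norml; split; lra.
Qed.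

(** The subdivision scheme followed by the derivatives of the functions in a
    Merrien space: no value of the function itself occurs in it. *)
Definition quarter_rule (R : realType) (lam u v : R) (F : R -> R) : Prop :=
  forall s t, dyadic_sub u v s t -> let m := (s + t) / 2 in
    F ((s + m) / 2) = lam * F s + (1 - lam) * F m /\
    F ((m + t) / 2) = lam * F t + (1 - lam) * F m.

(** The new values are convex combinations of the values at the ends and the
    middle, so the bounds on these three are inherited by both halves. *)
Lemma quarter_rule_range (R : realType) (lam u v A B : R) (F : R -> R) :
  0 <= lam <= 1 -> u < v -> {within `[u, v], continuous F} ->
  quarter_rule lam u v F ->
  A <= F u <= B -> A <= F ((u + v) / 2) <= B -> A <= F v <= B ->
  forall y, y \in `[u, v] -> A <= F y <= B.
Proof.
move=> lam01 uv cF Fq Fu Fm Fv; apply: dyadic_range => // s t st.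
suff : [/\ A <= F s <= B, A <= F ((s + t) / 2) <= B & A <= F t <= B] by case.
elim: st => {s t}// s t st [Fs Fst Ft]; have [Fl Fr] := Fq s t st;
  by split; rewrite ?Fl ?Fr//; nra.
Qed.

(** The order at the two ends and the midpoint is inherited by both halves. Two
    points y < z are then compared through the right end of a dyadic interval
    that contains y and is shorter than z - y. *)
Lemma quarter_rule_nondecreasing (R : realType) (lam u v : R) (F : R -> R) :
  0 <= lam <= 1 -> u < v -> {within `[u, v], continuous F} ->
  quarter_rule lam u v F ->
  F u <= F ((u + v) / 2) <= F v -> {in `[u, v] &, {homo F : s t / s <= t}}.
Proof.
move=> lam01 uv cF Fq Fuv.
have Fst s t : dyadic_sub u v s t -> F s <= F ((s + t) / 2) <= F t.
  elim=> {s t}// s t st Fst; have [Fl Fr] := Fq s t st;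
    by rewrite ?Fl ?Fr; nra.
have Frange s t y : dyadic_sub u v s t -> y \in `[s, t] -> F s <= F y <= F t.
  move=> st; have [us slt tv] := dyadic_itv uv st.
  have := Fst _ _ st => ?.
  apply: (quarter_rule_range lam01) => //; try lra.
    by apply: continuous_subspaceW cF => c; rewrite /= !in_itv/=; lra.
  by move=> p q pq; apply: Fq; apply: dyadic_trans pq.
have Fright s t y : dyadic_sub u v s t -> y \in `[t, v] -> F t <= F y.
  move=> st; elim: st y => {s t}[y|s t st IH y|s t st IH y].
  - by rewrite in_itv/= => yv; have -> : y = v by lra.
  - rewrite in_itv/= => /andP[my yv]; have [yt|ty] := leP y t.
      have := @Frange _ _ y (dyadic_right st).
      by rewrite in_itv/= my yt => /(_ isT)/andP[].
    have := Fst _ _ st; have := IH y.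
    by rewrite in_itv/= yv ltW//= => /(_ isT) ? /andP[_]; lra.
  - exact: IH.
move=> y z yuv; rewrite in_itv/= => zuv.
rewrite le_eqVlt => /orP[/eqP->//|yz].
have [s [t [st sy yt tsy]]] := @dyadic_small _ u v y (z - y) uv yuv ltac:(lra).
have := Frange s t y st; have := Fright s t z st.
by rewrite !in_itv/= sy yt => /(_ ltac:(lra)) ? /(_ isT)/andP[_]; lra.
Qed.

(** * Merrien spaces *)

Lemma theta_of_itv (R : realType) (beta : R) :
  -1 <= beta < 0 -> 0 < theta_of beta <= 4^-1.
Proof.
move=> b0; rewrite /theta_of.
have -> : 2^-1 * (beta / (beta - 1)) = (- beta) / (2 * (1 - beta)) by field; lra.
by rewrite divr_gt0 ?ler_pdivrMr//=; lra.
Qed.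

(** The formula for f'(m) expresses f(t) - f(s) by f'(s), f'(m) and f'(t);
    substituting it in the formula for f(m) gives f(m) - f(s) and f(t) - f(m) in
    the same terms, and hence the derivatives at the quarter points. *)
Lemma merrien_quarter_rule (R : realType) (beta u v : R) (f : R -> R) :
  -1 <= beta < 0 -> u < v -> merrien beta u v f ->
  quarter_rule (theta_of beta / (1 - 2 * theta_of beta)) u v (derive_on u v f).
Proof.
move=> /theta_of_itv; set th := theta_of beta => th0 uv [_ mf] s t st m.
have [_ slt _] := dyadic_itv uv st.
have [fm dfm] := mf _ _ st.
have [_ ->] := mf _ _ (dyadic_left st).
have [_ ->] := mf _ _ (dyadic_right st).
rewrite -/th -/m in fm dfm *.
move: (derive_on u v f) fm dfm => F fm dfm.
have fts : f t - f s = (t - s) * ((1 - 2 * th) * F m + th * (F s + F t)).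
  by rewrite dfm; field; lra.
have ft : f t = f s + (t - s) * ((1 - 2 * th) * F m + th * (F s + F t)).
  by rewrite -fts; ring.
by rewrite fm ft /m; split; field; lra.
Qed.

Lemma itv_half_comb (R : realType) (A B mu p q : R) :
  0 <= mu <= 2^-1 -> A <= p <= B -> A <= q <= B ->
  A <= (p + q) / 2 + mu * (p - q) <= B.
Proof. by nra. Qed.

(** Corner cutting: if p and q are the inner coefficients on [s, t] and m is the
    midpoint, the coefficients on the left half are f s, (f s + p) / 2,
    (p + q) / 2 - mu (q - p) and f m = (p + q) / 2, with
    mu = theta / (2 (1 - 2 theta)); symmetrically on the right. Since
    theta <= 1/4, mu is at most 1/2, so these are convex combinations. *)
Lemma merrien_range (R : realType) (beta u v A B : R) (f : R -> R) :
  -1 <= beta < 0 -> u < v -> merrien beta u v f ->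
  {in Bcoefs beta u v f, forall c, A <= c <= B} ->
  forall y, y \in `[u, v] -> A <= f y <= B.
Proof.
move=> /theta_of_itv; set th := theta_of beta => th0.
pose mu := th / (2 * (1 - 2 * th)).
have mu01 : 0 <= mu <= 2^-1 by rewrite /mu divr_ge0 ?ler_pdivrMr//=; lra.
move=> uv [C1 mf] cAB.
apply: dyadic_range => //; first by apply: derivable_on_continuous; case: C1.
set F := derive_on u v f in mf *.
suff H s t : dyadic_sub u v s t -> [/\ A <= f s <= B,
    A <= f s + th * (t - s) * F s <= B,
    A <= f t - th * (t - s) * F t <= B & A <= f t <= B].
  by move=> s t /H[].
elim=> {s t}[|s t st|s t st]; first by split; apply: cAB; rewrite !inE eqxx ?orbT.
all: have [fm dfm] := mf _ _ st; have [_ slt _] := dyadic_itv uv st.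
all: set m := (s + t) / 2 in fm dfm *; rewrite -/th in fm dfm.
all: move: (F s) (F t) (F m) fm dfm => Fs Ft Fm fm dfm.
all: set p := f s + _; set q := f t - _; move=> [cs cp cq ct].
all: have fmE : f m = (p + q) / 2 by rewrite fm /p /q; field.
all: have cm : A <= f m <= B by rewrite fmE; clear - cp cq; lra.
all: have dm : th * ((t - s) / 2) * Fm = mu * (q - p)
  by rewrite /mu dfm /p /q; clear - th0 slt; field; lra.
- have -> : m - s = (t - s) / 2 by rewrite /m; field.
  rewrite dm (_ : f s + _ = (f s + p) / 2); last by rewrite /p; field.
  split => //; first by clear - cs cp; lra.
  by rewrite fmE -mulrN opprB; exact: itv_half_comb.
- have -> : t - m = (t - s) / 2 by rewrite /m; field.
  rewrite dm (_ : f t - _ = (q + f t) / 2); last by rewrite /q; field.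
  split => //; last by clear - cq ct; lra.
  by rewrite fmE (addrC p); exact: itv_half_comb.
Qed.

(** * B-coefficients of the quasi-interpolant *)

Lemma merrien_lin (R : realType) (beta a b u v : R) (f g : R -> R) :
  u < v -> merrien beta u v f -> merrien beta u v g ->
  merrien beta u v (fun t => a * f t + b * g t).
Proof.
move=> uv [Cf mf] [Cg mg]; split; first exact: C1_on_lin.
move=> s t st m h; have [us slt tv] := dyadic_itv uv st.
have D r : s <= r <= t -> derive_on u v (fun t => a * f t + b * g t) r =
    a * derive_on u v f r + b * derive_on u v g r.
  move=> /andP[sr rt]; have ruv : r \in `[u, v].
    by rewrite in_itv/= (le_trans us sr) (le_trans rt tv).
  by apply: derive_on_lin => //; [case: Cf => + _|case: Cg => + _]; apply.
have [fm dfm] := mf _ _ st; have [gm dgm] := mg _ _ st.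
have mst : s <= m <= t by rewrite /m; clear - slt; lra.
rewrite !D ?lexx ?(ltW slt)//.
rewrite fm dfm gm dgm -/h.
move: (derive_on u v f) (derive_on u v g) => F G.
by move: (theta_of beta) (h) => th k; split; ring.
Qed.

Lemma Bcoefs_lin (R : realType) (beta a b u v : R) (f g : R -> R) :
  u < v -> C1_on u v f -> C1_on u v g ->
  Bcoefs beta u v (fun t => a * f t + b * g t) =
  mkseq (fun k => a * (Bcoefs beta u v f)`_k + b * (Bcoefs beta u v g)`_k) 4.
Proof.
move=> uv [df _] [dg _]; rewrite /Bcoefs /mkseq /=.
have D r : r \in `[u, v] -> derive_on u v (fun t => a * f t + b * g t) r =
    a * derive_on u v f r + b * derive_on u v g r.
  by move=> ruv; apply: derive_on_lin => //; [exact: df|exact: dg].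
by rewrite !D ?in_itv/= ?lexx ?(ltW uv)//; congr [:: _; _; _; _]; ring.
Qed.

Definition admissible (R : realType) (n : nat) (x beta : nat -> R) : Prop :=
  [/\ (0 < n)%N, (forall i, (i < n)%N -> x i < x i.+1)
    & (forall i, (1 <= i <= n)%N -> -1 <= beta i < 0)].

Lemma knot_lt (R : realType) (n : nat) (x beta : nat -> R) :
  admissible n x beta ->
  {in [pred i | (i <= n)%N] &, {homo x : i j / (i < j)%N >-> i < j}}.
Proof.
move=> [_ hx _] i j _ + ij; elim: j ij => // j IH.
rewrite ltnS leq_eqVlt => /orP[/eqP->|ij]; rewrite inE => jn; first exact: hx.
by apply: lt_trans (IH ij _) (hx _ jn); rewrite inE ltnW.
Qed.

Lemma knot_le (R : realType) (n : nat) (x beta : nat -> R) (i j : nat) :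
  admissible n x beta -> (i <= j)%N -> (j <= n)%N -> x i <= x j.
Proof.
move=> adm; rewrite leq_eqVlt => /orP[/eqP->//|ij] jn.
by apply/ltW/(knot_lt adm); rewrite ?inE// (leq_trans (ltnW ij)).
Qed.

Lemma has_coefs_lin (R : realType) (n : nat) (x beta : nat -> R) (a b : R)
    (f g : R -> R) (c d : nat -> seq R) : admissible n x beta ->
  has_coefs n x beta f c -> has_coefs n x beta g d ->
  has_coefs n x beta (fun t => a * f t + b * g t)
    (fun j => mkseq (fun k => a * (c j)`_k + b * (d j)`_k) 4).
Proof.
move=> adm [[Cf mf] fc] [[Cg mg] gd]; have [n0 _ _] := adm; split; first split.
- by apply: C1_on_lin => //; apply: (knot_lt adm); rewrite ?inE.
- case=> // j /= jn; apply: merrien_lin; [|exact: (mf j.+1)|exact: (mg j.+1)].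
  by apply: (knot_lt adm) => //; rewrite inE// ltnW.
- case=> // j /= jn; rewrite -fc// -gd//=; apply: Bcoefs_lin.
  + by apply: (knot_lt adm) => //; rewrite inE// ltnW.
  + by case: (mf j.+1 jn).
  + by case: (mg j.+1 jn).
Qed.

Lemma has_coefs_sum (R : realType) (n : nat) (x beta : nat -> R) (m : nat)
    (f : nat -> R -> R) (c : nat -> nat -> seq R) : admissible n x beta ->
  (forall i, (i <= m)%N -> has_coefs n x beta (f i) (c i)) ->
  has_coefs n x beta (fun t => \sum_(i < m.+1) f i t)
    (fun j => mkseq (fun k => \sum_(i < m.+1) (c i j)`_k) 4).
Proof.
move=> adm; elim: m => [|m IH] fc.
  have := has_coefs_lin 1 0 adm (fc 0 (leqnn 0)) (fc 0 (leqnn 0)).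
  congr has_coefs; apply/funext => t; first by rewrite big_ord1; ring.
  by apply: eq_mkseq => k; rewrite big_ord1; ring.
have := has_coefs_lin 1 1 adm (IH (fun i im => fc i (leqW im))) (fc m.+1 (leqnn _)).
congr has_coefs; apply/funext => t; first by rewrite [RHS]big_ord_recr/=; ring.
rewrite /mkseq/=; congr [:: _; _; _; _]; rewrite [RHS]big_ord_recr/=; ring.
Qed.

(** The coefficient of f (xi i) in the value of Q f at x i. The extreme values 1
    and 0 at the two ends of the interval make the formulas below uniform in i. *)
Definition even_weight (R : realType) (n : nat) (x beta : nat -> R) (i : nat) : R :=
  if i == 0%N then 1 else if i == n then 0 else omega x beta i.

Definition knot_value (R : realType) (n : nat) (x beta : nat -> R) (f : R -> R)
    (i : nat) : R :=
  let w := even_weight n x beta i in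
  w * f (xi_node x beta i) + (1 - w) * f (eta_node n x beta i).

(** With [even_weight] in place of omega, the end splines have the same lists as
    the interior ones, so that one computation covers all subintervals. *)
Lemma coefs_evenE (R : realType) (n : nat) (x beta : nat -> R) (i j : nat) :
  (i <= n)%N -> (j < n)%N -> coefs_even n x beta i j.+1 =
  let w := even_weight n x beta i in
  if i == j then [:: w; 0; 0; 0] else if i == j.+1 then [:: 0; 0; 1; w]
  else [:: 0; 0; 0; 0].
Proof.
move=> i_n jn; rewrite /coefs_even /even_weight.
have [->|i0] := eqVneq i 0%N; first by rewrite eqSS (eq_sym 0%N j); case: eqP.
have [->|i_n'] := eqVneq i n; first by rewrite (gtn_eqF jn) (eq_sym n).
rewrite (eq_sym j.+1) eqSS (eq_sym j).
by have [->|//] := eqVneq i j.+1; rewrite gtn_eqF.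
Qed.

Lemma coefs_oddE (R : realType) (n : nat) (x beta : nat -> R) (i j : nat) :
  (i <= n)%N -> (j < n)%N -> coefs_odd n x beta i j.+1 =
  let w := even_weight n x beta i in
  if i == j then [:: 1 - w; 1; 0; 0] else if i == j.+1 then [:: 0; 0; 0; 1 - w]
  else [:: 0; 0; 0; 0].
Proof.
move=> i_n jn; rewrite /coefs_odd /even_weight.
have [->|i0] := eqVneq i 0%N.
  by rewrite eqSS (eq_sym 0%N j) subrr; case: eqP.
have [->|i_n'] := eqVneq i n; first by rewrite (gtn_eqF jn) (eq_sym n) subr0.
rewrite (eq_sym j.+1) eqSS (eq_sym j).
by have [->|//] := eqVneq i j.+1; rewrite gtn_eqF.
Qed.

Lemma sum_two_terms (V : zmodType) (n j : nat) (P S : nat -> V) : (j < n)%N ->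
  \sum_(i < n.+1) (if i == j :> nat then P i else if i == j.+1 :> nat then S i else 0)
  = P j + S j.+1.
Proof.
move=> jn; have jn1 : (j < n.+1)%N by rewrite ltnW.
rewrite (bigD1 (Ordinal jn1))//= eqxx; congr (_ + _).
rewrite (bigD1 (Ordinal (jn : j.+1 < n.+1)%N))/=; last first.
  by rewrite -val_eqE/= gtn_eqF.
rewrite gtn_eqF// eqxx big1 ?addr0// => i /andP[].
by rewrite -!val_eqE/= => /negPf-> /negPf->.
Qed.

Lemma quasi_interp_coefs (R : realType) (n : nat) (x beta : nat -> R)
    (B : nat -> R -> R) (f : R -> R) : admissible n x beta ->
  Bspline_family n x beta B ->
  has_coefs n x beta (quasi_interp n x beta B f) (fun j =>
    [:: knot_value n x beta f j.-1; f (eta_node n x beta j.-1);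
        f (xi_node x beta j); knot_value n x beta f j]).
Proof.
move=> adm hB.
pose c i j := mkseq (fun k => f (xi_node x beta i) * (coefs_even n x beta i j)`_k
  + f (eta_node n x beta i) * (coefs_odd n x beta i j)`_k) 4.
have [gs cs] := @has_coefs_sum _ n x beta n (fun i t => f (xi_node x beta i) * B i.*2 t
  + f (eta_node n x beta i) * B i.*2.+1 t) c adm
  (fun i i_n => has_coefs_lin _ _ adm (hB i i_n).1 (hB i i_n).2).
split=> // -[//|j] /= jn; rewrite cs//=.
have E k (P S : nat -> R) : (k < 4)%N -> 
  (forall i, (i <= n)%N -> (c i j.+1)`_k =
    if i == j then P i else if i == j.+1 then S i else 0) ->
  \sum_(i < n.+1) (c i j.+1)`_k = P j + S j.+1.
  move=> k4 PS; rewrite -(sum_two_terms _ _ jn); apply: eq_bigr => i _.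
  by rewrite PS// -ltnS.
pose w := even_weight n x beta.
pose X i := f (xi_node x beta i); pose Y i := f (eta_node n x beta i).
rewrite /mkseq/=; congr [:: _; _; _; _].
- rewrite (E 0%N (fun i => w i * X i + (1 - w i) * Y i) (fun=> 0))// ?addr0//.
  move=> i i_n; rewrite nth_mkseq// coefs_evenE// coefs_oddE//=.
  by case: ifP => _; [|case: ifP => _]; rewrite /= /X /Y /w; ring.
- rewrite (E 1%N Y (fun=> 0))// ?addr0//.
  move=> i i_n; rewrite nth_mkseq// coefs_evenE// coefs_oddE//=.
  by case: ifP => _; [|case: ifP => _]; rewrite /= /X /Y /w; ring.
- rewrite (E 2%N (fun=> 0) X)// ?add0r//.
  move=> i i_n; rewrite nth_mkseq// coefs_evenE// coefs_oddE//=.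
  by case: ifP => _; [|case: ifP => _]; rewrite /= /X /Y /w; ring.
- rewrite (E 3%N (fun=> 0) (fun i => w i * X i + (1 - w i) * Y i))// ?add0r//.
  move=> i i_n; rewrite nth_mkseq// coefs_evenE// coefs_oddE//=.
  by case: ifP => _; [|case: ifP => _]; rewrite /= /X /Y /w; ring.
Qed.

(** * Convexity and divided differences *)

Lemma convex_function_itvP (R : realType) (a b : R) (f : R -> R) :
  convex_function `[a, b] f <->
  (forall l y z, 0 <= l <= 1 -> y \in `[a, b] -> z \in `[a, b] ->
     f (l * y + (1 - l) * z) <= l * f y + (1 - l) * f z).
Proof.
split=> [cf l y z /andP[l0 l1] yab zab|cf t y z yab zab].
  by have := cf (Itv01 l0 l1) y z; apply; rewrite inE.
rewrite !inE/= in yab zab.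
by apply: (cf (t%:num)) => //; rewrite ge0 le1.
Qed.

Lemma convex_function_slopes (R : realType) (a b p q r : R) (f : R -> R) :
  convex_function `[a, b] f -> a <= p -> p < q -> q < r -> r <= b ->
  diff_quot f p q <= diff_quot f q r.
Proof.
move=> /convex_function_itvP cf ap pq qr rb.
have rp : 0 < r - p by lra.
pose l := (r - q) / (r - p).
have l01 : 0 <= l <= 1 by rewrite divr_ge0 ?ler_pdivrMr//=; lra.
have {cf} := cf l p r l01; rewrite !in_itv/= => /(_ ltac:(lra) ltac:(lra)).
have -> : l * p + (1 - l) * r = q by rewrite /l; field; lra.
move=> fq; rewrite /diff_quot ler_pdivrMr ?subr_gt0//.
rewrite mulrAC ler_pdivlMr ?subr_gt0//.
have : (r - p) * f q <= (r - q) * f p + (q - p) * f r.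
  rewrite -ler_pdivlMl//; apply: le_trans fq _; rewrite le_eqVlt; apply/orP; left.
  by apply/eqP; rewrite /l; field; lra.
by move: (f p) (f q) (f r) => fp {}fq fr; clear; lra.
Qed.

(** The increase of consecutive slopes is convexity at a point strictly between
    two others; the cases l = 0, l = 1 and y = z are trivial, and y > z is the case
    y < z for 1 - l. *)
Lemma slopes_convex_function (R : realType) (a b : R) (f : R -> R) :
  (forall p q r, a <= p -> p < q -> q < r -> r <= b ->
     diff_quot f p q <= diff_quot f q r) ->
  convex_function `[a, b] f.
Proof.
move=> H; apply/convex_function_itvP.
have main l y z : 0 < l < 1 -> a <= y -> y < z -> z <= b ->
    f (l * y + (1 - l) * z) <= l * f y + (1 - l) * f z.
  move=> /andP[l0 l1] ay yz zb.
  set q := _ + (1 - l) * z.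
  have qy : q - y = (1 - l) * (z - y) by rewrite /q; ring.
  have zq : z - q = l * (z - y) by rewrite /q; ring.
  have yzp : 0 < z - y by rewrite subr_gt0.
  have l1p : 0 < 1 - l by rewrite subr_gt0.
  have := H y q z ay; rewrite -subr_gt0 qy -(subr_gt0 q) zq /diff_quot qy zq.
  rewrite !mulr_gt0//.
  move=> /(_ isT isT zb).
  rewrite ler_pdivrMr ?mulr_gt0// mulrAC ler_pdivlMr ?mulr_gt0//.
  rewrite !mulrA ler_pM2r//.
  by move: (f y) (f q) (f z) => fy fq fz; lra.
move=> l y z /andP[l0 l1] /[!in_itv]/= /andP[ay yb] /andP[az zb].
have [->|ln0] := eqVneq l 0; first by rewrite !mul0r !add0r subr0 !mul1r.
have [->|ln1] := eqVneq l 1; first by rewrite subrr !mul0r !addr0 !mul1r.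
have lp : 0 < l by rewrite lt_neqAle eq_sym ln0.
have lq : l < 1 by rewrite lt_neqAle ln1.
have [yz|zy|->] := ltgtP y z.
- by apply: main => //; rewrite lp.
- have l01 : 0 < 1 - l < 1 by clear - lp lq; lra.
  have := main _ _ _ l01 az zy yb.
  by rewrite subKr (addrC (_ * z)) (addrC (_ * f z)).
- by rewrite -!mulrDl addrC subrK !mul1r.
Qed.

(** * Nodes and weights *)

Lemma theta_h_itv (R : realType) (n : nat) (x beta : nat -> R) (i : nat) :
  admissible n x beta -> (i < n)%N ->
  0 < thetah x beta i.+1 <= (x i.+1 - x i) / 4.
Proof.
move=> [_ hx hb] i_n; have /theta_of_itv := hb i.+1 i_n.
rewrite /thetah/=; have := hx i i_n; move: (theta_of _) => th; nra.
Qed.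

Lemma eta_nodeE (R : realType) (n : nat) (x beta : nat -> R) (i : nat) :
  (i < n)%N -> eta_node n x beta i = x i + thetah x beta i.+1.
Proof. by move=> i_n; rewrite /eta_node ltn_eqF. Qed.

Lemma xi_nodeS (R : realType) (x beta : nat -> R) (i : nat) :
  xi_node x beta i.+1 = x i.+1 - thetah x beta i.+1.
Proof. by []. Qed.

(** The weights are those that write x i as the convex combination of xi i and
    eta i. The two gap identities turn a difference of consecutive B-coefficients
    into a divided difference of f. *)
Lemma weight_gap_right (R : realType) (n : nat) (x beta : nat -> R) (i : nat) :
  admissible n x beta -> (i < n)%N -> 
  even_weight n x beta i * (eta_node n x beta i - xi_node x beta i) =
  thetah x beta i.+1.
Proof.
move=> adm i_n; rewrite eta_nodeE// /even_weight /xi_node (ltn_eqF i_n).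
case: i i_n => [|i] i_n /=; first by ring.
have := theta_h_itv adm i_n; have := theta_h_itv adm (ltnW i_n).
rewrite /omega; move: (thetah _ _ i.+1) (thetah _ _ i.+2) => p q p0 q0.
by field; lra.
Qed.

Lemma weight_gap_left (R : realType) (n : nat) (x beta : nat -> R) (i : nat) :
  admissible n x beta -> (i < n)%N ->
  (1 - even_weight n x beta i.+1) *
    (eta_node n x beta i.+1 - xi_node x beta i.+1) = thetah x beta i.+1.
Proof.
move=> adm i_n; rewrite xi_nodeS /even_weight/=.
have [e|ne] := eqVneq i.+1 n; first by rewrite /eta_node e eqxx; ring.
have i_n' : (i.+1 < n)%N by rewrite ltn_neqAle ne.
rewrite eta_nodeE//.
have := theta_h_itv adm i_n'; have := theta_h_itv adm i_n.
rewrite /omega; move: (thetah _ _ i.+1) (thetah _ _ i.+2) => p q p0 q0.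
by field; lra.
Qed.

Lemma even_weight_itv (R : realType) (n : nat) (x beta : nat -> R) (i : nat) :
  admissible n x beta -> (i <= n)%N -> 0 <= even_weight n x beta i <= 1.
Proof.
move=> adm i_n; rewrite /even_weight.
have [_|i0] := eqVneq i 0%N; first by rewrite ler01 lexx.
have [_|ne] := eqVneq i n; first by rewrite ler01 lexx.
case: i i_n i0 ne => // i i_n _ ne.
have i_n' : (i.+1 < n)%N by rewrite ltn_neqAle ne.
have := theta_h_itv adm i_n'; have := theta_h_itv adm i_n.
rewrite /omega; move: (thetah _ _ i.+1) (thetah _ _ i.+2) => p q p0 q0.
by rewrite divr_ge0 ?ler_pdivrMr//=; lra.
Qed.

Lemma xi_lt_eta (R : realType) (n : nat) (x beta : nat -> R) (i : nat) :
  admissible n x beta -> (i <= n)%N -> xi_node x beta i < eta_node n x beta i.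
Proof.
move=> adm; have [n0 _ _] := adm; rewrite leq_eqVlt => /orP[/eqP->|i_n].
  case: n n0 adm => // n _ adm.
  rewrite xi_nodeS /eta_node eqxx; have := theta_h_itv adm (ltnSn n); lra.
rewrite eta_nodeE//; have := theta_h_itv adm i_n.
case: i i_n => [|i] i_n; first by rewrite /xi_node/=; lra.
by rewrite xi_nodeS; have := theta_h_itv adm (ltnW i_n); lra.
Qed.

Lemma eta_lt_xi (R : realType) (n : nat) (x beta : nat -> R) (i : nat) :
  admissible n x beta -> (i < n)%N -> eta_node n x beta i < xi_node x beta i.+1.
Proof.
move=> adm i_n; rewrite eta_nodeE// xi_nodeS.
by have := theta_h_itv adm i_n; lra.
Qed.

Lemma xi_node_ge (R : realType) (n : nat) (x beta : nat -> R) (i : nat) :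
  admissible n x beta -> (i <= n)%N -> x 0%N <= xi_node x beta i.
Proof.
move=> adm; case: i => [|i] i_n; first by rewrite /xi_node.
have := knot_le adm (leq0n i) (ltnW i_n); have := theta_h_itv adm i_n.
by rewrite xi_nodeS; lra.
Qed.

Lemma eta_node_le (R : realType) (n : nat) (x beta : nat -> R) (i : nat) :
  admissible n x beta -> (i <= n)%N -> eta_node n x beta i <= x n.
Proof.
move=> adm; rewrite leq_eqVlt => /orP[/eqP->|i_n].
  by rewrite /eta_node eqxx.
have := knot_le adm i_n (leqnn n); have := theta_h_itv adm i_n.
by rewrite eta_nodeE//; lra.
Qed.

Lemma nodes_itv (R : realType) (n : nat) (x beta : nat -> R) (i : nat) :
  admissible n x beta -> (i <= n)%N ->
  xi_node x beta i \in `[x 0%N, x n] /\ eta_node n x beta i \in `[x 0%N, x n].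
Proof.
move=> adm i_n; rewrite !in_itv/=.
have := xi_lt_eta adm i_n; have := xi_node_ge adm i_n.
by have := eta_node_le adm i_n; split; lra.
Qed.

(** * Derivatives of generalized splines *)

Lemma knot_cover (R : realType) (n : nat) (x beta : nat -> R) (t : R) :
  admissible n x beta -> t \in `[x 0%N, x n] ->
  exists2 i, (i < n)%N & t \in `[x i, x i.+1].
Proof.
move=> adm; have [n0 _ _] := adm.
suff H m : (0 < m <= n)%N -> t \in `[x 0%N, x m] ->
    exists2 i, (i < m)%N & t \in `[x i, x i.+1] by apply: H; rewrite n0 leqnn.
elim: m => // -[|m] IH mn tm; first by exists 0%N.
have [tx|xt] := leP t (x m.+1).
  have [||i im ti] := IH; first by case/andP: mn => _ /ltnW.
    by move: tm; rewrite !in_itv/= tx => /andP[->].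
  by exists i => //; exact: ltnW.
exists m.+1 => //; move: tm; rewrite !in_itv/= => /andP[_ ->].
by rewrite (ltW xt).
Qed.

Lemma GS2_derive_on (R : realType) (n : nat) (x beta : nat -> R) (g : R -> R)
    (i : nat) (t : R) : admissible n x beta -> GS2 n x beta g -> (i < n)%N ->
  t \in `[x i, x i.+1] ->
  derive_on (x i) (x i.+1) g t = derive_on (x 0%N) (x n) g t.
Proof.
move=> adm [[dg _] _] i_n ti; have [_ hx _] := adm.
have x0i := knot_le adm (leq0n i) (ltnW i_n).
have xin := knot_le adm i_n (leqnn n).
apply: derive_on_sub => //; first exact: hx.
apply: dg; move: ti; rewrite !in_itv/= => /andP[? ?].
by rewrite (le_trans x0i)//= (le_trans _ xin).
Qed.

(** The bound theta <= 1/4 gives a weight in [0, 1], in fact at most 1/2. *)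
Lemma GS2_quarter (R : realType) (n : nat) (x beta : nat -> R) (g : R -> R)
    (i : nat) : admissible n x beta -> GS2 n x beta g -> (i < n)%N ->
  exists2 lam, 0 <= lam <= 1 & [/\ x i < x i.+1,
    {within `[x i, x i.+1], continuous (derive_on (x i) (x i.+1) g)} &
    quarter_rule lam (x i) (x i.+1) (derive_on (x i) (x i.+1) g)].
Proof.
move=> [_ hx hb] [_ mg] i_n; have mi := mg i.+1 i_n; have bi := hb i.+1 i_n.
exists (theta_of (beta i.+1) / (1 - 2 * theta_of (beta i.+1))).
  have := theta_of_itv bi; move: (theta_of _) => th th0.
  by rewrite divr_ge0 ?ler_pdivrMr//=; lra.
split; [exact: hx| by case: mi => -[]|].
by apply: merrien_quarter_rule => //; exact: hx.
Qed.

Lemma GS2_derive_range (R : realType) (n : nat) (x beta : nat -> R)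
    (g : R -> R) (A B : R) (i : nat) : admissible n x beta -> GS2 n x beta g ->
  (i < n)%N -> let F := derive_on (x 0%N) (x n) g in
  A <= F (x i) <= B -> A <= F ((x i + x i.+1) / 2) <= B ->
  A <= F (x i.+1) <= B ->
  forall t, t \in `[x i, x i.+1] -> A <= F t <= B.
Proof.
move=> adm gs i_n F Fl Fm Fr t ti.
have [lam lam01 [xx cF qF]] := GS2_quarter adm gs i_n.
have E s : s \in `[x i, x i.+1] -> F s = derive_on (x i) (x i.+1) g s.
  by move=> si; rewrite (GS2_derive_on adm gs i_n si).
have xl : x i \in `[x i, x i.+1] by rewrite in_itv/= lexx ltW.
have xr : x i.+1 \in `[x i, x i.+1] by rewrite in_itv/= lexx ltW.
have xm : (x i + x i.+1) / 2 \in `[x i, x i.+1].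
  by rewrite in_itv/=; clear - xx; lra.
rewrite (E _ xl) in Fl; rewrite (E _ xm) in Fm; rewrite (E _ xr) in Fr.
rewrite (E _ ti).
exact: (quarter_rule_range lam01 xx cF qF Fl Fm Fr).
Qed.

(** A one-sided form of the range property: the sum of three nonnegative numbers
    is an upper bound of each. *)
Lemma GS2_derive_ge0 (R : realType) (n : nat) (x beta : nat -> R)
    (g : R -> R) (i : nat) : admissible n x beta -> GS2 n x beta g ->
  (i < n)%N -> let F := derive_on (x 0%N) (x n) g in
  0 <= F (x i) -> 0 <= F ((x i + x i.+1) / 2) -> 0 <= F (x i.+1) ->
  forall t, t \in `[x i, x i.+1] -> 0 <= F t.
Proof.
move=> adm gs i_n F Fl Fm Fr t ti.
have := GS2_derive_range adm gs i_n; rewrite /= -/F => range.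
pose M := F (x i) + F ((x i + x i.+1) / 2) + F (x i.+1).
suff /andP[] : 0 <= F t <= M by [].
apply: range ti; rewrite /M; move: (F (x i)) (F (x i.+1)) (F (_ / 2)) Fl Fm Fr;
  by clear => l r m; lra.
Qed.

(** Monotonicity on each subinterval extends to the whole interval because
    neighbouring subintervals share a knot. *)
Lemma GS2_derive_nondecreasing (R : realType) (n : nat) (x beta : nat -> R)
    (g : R -> R) : admissible n x beta -> GS2 n x beta g ->
  let F := derive_on (x 0%N) (x n) g in
  (forall i, (i < n)%N -> F (x i) <= F ((x i + x i.+1) / 2) <= F (x i.+1)) ->
  {in `[x 0%N, x n] &, {homo F : s t / s <= t}}.
Proof.
move=> adm gs F Fmid s t s0n t0n st.
have local i : (i < n)%N -> {in `[x i, x i.+1] &, {homo F : y z / y <= z}}.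
  move=> i_n; have [lam lam01 [xx cF qF]] := GS2_quarter adm gs i_n.
  have E y : y \in `[x i, x i.+1] -> F y = derive_on (x i) (x i.+1) g y.
    by move=> yi; rewrite (GS2_derive_on adm gs i_n yi).
  move=> y z yi zi yz; rewrite !E//.
  apply: quarter_rule_nondecreasing qF _ _ _ yi zi yz => //.
  by rewrite -!E ?Fmid// in_itv/=; clear - xx; lra.
have knots i j : (i <= j)%N -> (j <= n)%N -> F (x i) <= F (x j).
  elim: j => [|j IH]; first by rewrite leqn0 => /eqP->.
  rewrite leq_eqVlt => /orP[/eqP->//|ij jn].
  apply: le_trans (IH ij (ltnW jn)) _.
  by have /andP[] := Fmid j jn; exact: le_trans.
have [j jn sj] := knot_cover adm s0n; have [k kn tk] := knot_cover adm t0n.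
have xj : x j < x j.+1 by case: adm => _ + _; apply.
have xk : x k < x k.+1 by case: adm => _ + _; apply.
have inj : x j.+1 \in `[x j, x j.+1] by rewrite in_itv/= lexx ltW.
have ink : x k \in `[x k, x k.+1] by rewrite in_itv/= lexx ltW.
have [jk|kj|jk] := ltngtP j k; last by apply: (local j) => //; rewrite jk.
  apply: (@le_trans _ _ (F (x j.+1))).
    by apply: (local j) => //; move: sj; rewrite in_itv/= => /andP[].
  apply: (le_trans (knots _ _ jk (ltnW kn))).
  by apply: (local k) => //; move: tk; rewrite in_itv/= => /andP[].
suff -> : s = t by [].
have := knot_le adm kj (ltnW jn); move: sj tk; rewrite !in_itv/=.
by clear - st; lra.
Qed.

(** The derivative of Q f at a knot is the slope of f between the two nodes around
    this knot, because the differences between the inner and the outer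
    B-coefficients are multiples of f (eta i) - f (xi i). At a midpoint it is the
    slope between the two inner nodes, which are at the distance (1 - 2 theta) h
    and carry the two inner coefficients. *)
Lemma quasi_interp_derive (R : realType) (n : nat) (x beta : nat -> R)
    (B : nat -> R -> R) (f : R -> R) (i : nat) : admissible n x beta ->
  Bspline_family n x beta B -> (i < n)%N ->
  let F := derive_on (x 0%N) (x n) (quasi_interp n x beta B f) in
  [/\ F (x i) = diff_quot f (xi_node x beta i) (eta_node n x beta i),
      F ((x i + x i.+1) / 2) =
        diff_quot f (eta_node n x beta i) (xi_node x beta i.+1)
    & F (x i.+1) = diff_quot f (xi_node x beta i.+1) (eta_node n x beta i.+1)].
Proof.
move=> adm hB i_n F.
have [gs gc] := quasi_interp_coefs f adm hB.
have xx : x i < x i.+1 by case: adm => _ + _; apply.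
have E y : y \in `[x i, x i.+1] ->
    derive_on (x i) (x i.+1) (quasi_interp n x beta B f) y = F y.
  by move=> yi; exact: (GS2_derive_on adm gs i_n).
have xl : x i \in `[x i, x i.+1] by rewrite in_itv/= lexx ltW.
have xr : x i.+1 \in `[x i, x i.+1] by rewrite in_itv/= lexx ltW.
have xm : (x i + x i.+1) / 2 \in `[x i, x i.+1].
  by rewrite in_itv/=; clear - xx; lra.
have [_ Fm] := (gs.2 i.+1 i_n).2 _ _ (dyadic_whole _ _).
have := gc i.+1 i_n; rewrite /Bcoefs/= !E// in Fm * => -[g0 c1 c2 g3].
have ti := theta_h_itv adm i_n; have tE : thetah x beta i.+1 =
  theta_of (beta i.+1) * (x i.+1 - x i) by [].
have gr := weight_gap_right adm i_n; have gl := weight_gap_left adm i_n.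
have li := xi_lt_eta adm (ltnW i_n); have ri := xi_lt_eta adm i_n.
have mi := eta_lt_xi adm i_n.
have mE : xi_node x beta i.+1 - eta_node n x beta i =
    (1 - 2 * theta_of (beta i.+1)) * (x i.+1 - x i).
  by rewrite eta_nodeE// xi_nodeS tE; ring.
have t0 : thetah x beta i.+1 != 0 by rewrite gt_eqF//; case/andP: ti.
split.
- have tF : thetah x beta i.+1 * F (x i) =
      f (eta_node n x beta i) - knot_value n x beta f i.
    by rewrite -c1 -g0 tE; ring.
  apply: (mulfI t0); rewrite tF /knot_value -gr /diff_quot; field.
  by rewrite subr_eq0 gt_eqF.
- rewrite Fm /diff_quot mE -c1 -c2; rewrite tE in ti.
  move: (theta_of _) ti (F (x i)) (F (x i.+1)) => th ti Fl Fr.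
  by clear - xx ti; field; nra.
- have tF : thetah x beta i.+1 * F (x i.+1) =
      knot_value n x beta f i.+1 - f (xi_node x beta i.+1).
    by rewrite -c2 -g3 tE; ring.
  apply: (mulfI t0); rewrite tF /knot_value -gl /diff_quot; field.
  by rewrite subr_eq0 gt_eqF.
Qed.

(** * Properties of the quasi-interpolant *)

Lemma quasi_interp_affine (R : realType) (n : nat) (x beta : nat -> R)
    (B : nat -> R -> R) (p : {poly R}) (t : R) : admissible n x beta ->
  Bspline_family n x beta B -> (size p <= 2)%N -> t \in `[x 0%N, x n] ->
  quasi_interp n x beta B (fun s => p.[s]) t = p.[t].
Proof.
move=> adm hB p2 t0n; have [n0 _ _] := adm.
set g := quasi_interp _ _ _ _ _.
have pE s : p.[s] = p`_0 + p`_1 * s.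
  by rewrite (horner_coef_wide _ p2) !big_ord_recl big_ord0/= expr0 expr1; ring.
have slope q r : q < r -> diff_quot (fun s => p.[s]) q r = p`_1.
  by move=> qr; rewrite /diff_quot !pE; field; rewrite subr_eq0 gt_eqF.
have [gs gc] := quasi_interp_coefs (fun s => p.[s]) adm hB.
have x0n := knot_le adm (leq0n n) (leqnn n).
have x00 : x 0%N \in `[x 0%N, x n] by rewrite in_itv/= lexx.
have g0 : g (x 0%N) = p.[x 0%N].
  have := gc 1%N n0; rewrite /Bcoefs/= => -[g0 _ _ _].
  by rewrite [LHS]g0 /knot_value /even_weight /xi_node/= subrr mul0r addr0 mul1r.
have dg s : s \in `[x 0%N, x n] -> derive_on (x 0%N) (x n) g s = p`_1.
  move=> /(knot_cover adm)[i i_n si].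
  have [Fl Fm Fr] := quasi_interp_derive (fun s => p.[s]) adm hB i_n.
  rewrite (slope _ _ (xi_lt_eta adm (ltnW i_n))) in Fl.
  rewrite (slope _ _ (eta_lt_xi adm i_n)) in Fm.
  rewrite (slope _ _ (xi_lt_eta adm i_n)) in Fr.
  apply/eqP; rewrite eq_le andbC.
  by apply: (GS2_derive_range adm gs i_n) si; rewrite ?Fl ?Fm ?Fr lexx.
have x0t : x 0%N <= t by move: t0n; rewrite in_itv/= => /andP[].
have [c ct gE] : exists2 c, c \in `[x 0%N, t] &
    g t - g (x 0%N) = derive_on (x 0%N) (x n) g c * (t - x 0%N).
  exact: MVT_on gs.1.1 x00 t0n x0t.
have c0n : c \in `[x 0%N, x n].
  by move: ct t0n; rewrite !in_itv/=; clear; lra.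
by move: gE; rewrite g0 dg// !pE => /eqP; rewrite subr_eq => /eqP ->; ring.
Qed.

Lemma quasi_interp_range (R : realType) (n : nat) (x beta : nat -> R)
    (B : nat -> R -> R) (f : R -> R) (C D : R) : admissible n x beta ->
  Bspline_family n x beta B ->
  (forall t, t \in `[x 0%N, x n] -> C <= f t <= D) ->
  forall t, t \in `[x 0%N, x n] -> C <= quasi_interp n x beta B f t <= D.
Proof.
move=> adm hB fCD t /(knot_cover adm)[i i_n ti].
have [gs gc] := quasi_interp_coefs f adm hB.
have [_ hx hb] := adm.
have fxi j : (j <= n)%N -> C <= f (xi_node x beta j) <= D.
  by move=> jn; apply: fCD; case: (nodes_itv adm jn).
have feta j : (j <= n)%N -> C <= f (eta_node n x beta j) <= D.
  by move=> jn; apply: fCD; case: (nodes_itv adm jn).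
have fkv j : (j <= n)%N -> C <= knot_value n x beta f j <= D.
  move=> jn; have := even_weight_itv adm jn; have := fxi j jn; have := feta j jn.
  rewrite /knot_value; move: (even_weight _ _ _ _) (f _) (f _) => w p q.
  by clear; nra.
apply: (merrien_range (hb i.+1 i_n) (hx i i_n) (gs.2 i.+1 i_n)) ti => c.
rewrite gc// !inE/= => /or4P[] /eqP ->.
- exact: fkv (ltnW i_n).
- exact: feta (ltnW i_n).
- exact: fxi.
- exact: fkv.
Qed.

Lemma quasi_interp_norm (R : realType) (n : nat) (x beta : nat -> R)
    (B : nat -> R -> R) : admissible n x beta -> Bspline_family n x beta B ->
  op_norm (x 0%N) (x n) (quasi_interp n x beta B) = 1%:E.
Proof.
move=> adm hB; apply/eqP; rewrite eq_le; apply/andP; split.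
  apply: ge_ereal_sup => _ [f [_ f1] <-]; apply: ge_ereal_sup => _ [t t0n <-].
  rewrite lee_fin ler_norml; apply: (quasi_interp_range adm hB) => // s s0n.
  rewrite -ler_norml -lee_fin; apply: le_trans f1.
  by apply: ereal_sup_ubound; exists s.
have x0n := knot_le adm (leq0n n) (leqnn n).
have x00 : x 0%N \in `[x 0%N, x n] by rewrite in_itv/= lexx.
apply: (@le_trans _ _ (unif_norm (x 0%N) (x n)
    (quasi_interp n x beta B (fun s => (1 : {poly R}).[s])))); last first.
  apply: ereal_sup_ubound; eexists; last by []; split.
    rewrite (_ : (fun s => _) = cst 1).
      exact: continuous_subspaceT (@cst_continuous _ _ _).
    by apply/funext => s; rewrite hornerC.
  by apply: ge_ereal_sup => _ [t _ <-]; rewrite hornerC normr1.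
apply: ereal_sup_ubound; exists (x 0%N) => //.
by rewrite (quasi_interp_affine adm hB) ?size_poly1// hornerC normr1.
Qed.

Lemma quasi_interp_increasing (R : realType) (n : nat) (x beta : nat -> R)
    (B : nat -> R -> R) (f : R -> R) : admissible n x beta ->
  Bspline_family n x beta B -> {in `[x 0%N, x n] &, {homo f : s t / s <= t}} ->
  {in `[x 0%N, x n] &, {homo quasi_interp n x beta B f : s t / s <= t}}.
Proof.
move=> adm hB fincr s t s0n t0n st.
have [gs _] := quasi_interp_coefs f adm hB.
have [c cst gE] := MVT_on gs.1.1 s0n t0n st.
have slope q r : q < r -> q \in `[x 0%N, x n] -> r \in `[x 0%N, x n] ->
    0 <= diff_quot f q r.
  by move=> qr qn rn; rewrite divr_ge0 ?subr_ge0 ?fincr// ltW.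
have : c \in `[x 0%N, x n].
  by move: cst s0n t0n; rewrite !in_itv/=; clear; lra.
move=> /(knot_cover adm)[i i_n ci].
have [xl el] := nodes_itv adm (ltnW i_n); have [xr er] := nodes_itv adm i_n.
have [Fl Fm Fr] := quasi_interp_derive f adm hB i_n.
rewrite -subr_ge0 gE; apply: mulr_ge0; last by rewrite subr_ge0.
apply: (GS2_derive_ge0 adm gs i_n) ci; [rewrite Fl|rewrite Fm|rewrite Fr].
- exact: slope (xi_lt_eta adm (ltnW i_n)) xl el.
- exact: slope (eta_lt_xi adm i_n) el xr.
- exact: slope (xi_lt_eta adm i_n) xr er.
Qed.

Lemma quasi_interpN (R : realType) (n : nat) (x beta : nat -> R)
    (B : nat -> R -> R) (f : R -> R) (t : R) :
  quasi_interp n x beta B (fun s => - f s) t = - quasi_interp n x beta B f t.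
Proof.
by rewrite /quasi_interp -sumrN; apply: eq_bigr => i _; rewrite !mulNr opprD.
Qed.

Lemma quasi_interp_convex (R : realType) (n : nat) (x beta : nat -> R)
    (B : nat -> R -> R) (f : R -> R) : admissible n x beta ->
  Bspline_family n x beta B -> convex_function `[x 0%N, x n] f ->
  convex_function `[x 0%N, x n] (quasi_interp n x beta B f).
Proof.
move=> adm hB fconv.
have [gs _] := quasi_interp_coefs f adm hB.
have Fincr : {in `[x 0%N, x n] &, {homo derive_on (x 0%N) (x n)
    (quasi_interp n x beta B f) : s t / s <= t}}.
  apply: (GS2_derive_nondecreasing adm gs) => i i_n.
  have [-> -> ->] := quasi_interp_derive f adm hB i_n.
  have lt1 := xi_lt_eta adm (ltnW i_n); have lt2 := eta_lt_xi adm i_n.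
  have lt3 := xi_lt_eta adm i_n.
  have ge0 := xi_node_ge adm (ltnW i_n); have len := eta_node_le adm i_n.
  rewrite !(convex_function_slopes fconv)//.
  - exact: le_trans (ltW lt1).
  - exact: le_trans (ltW lt3) len.
apply: slopes_convex_function => p q r ap pq qr rb.
have p0n : p \in `[x 0%N, x n] by rewrite in_itv/=; clear - ap pq qr rb; lra.
have q0n : q \in `[x 0%N, x n] by rewrite in_itv/=; clear - ap pq qr rb; lra.
have r0n : r \in `[x 0%N, x n] by rewrite in_itv/=; clear - ap pq qr rb; lra.
have [c cpq cE] := MVT_on gs.1.1 p0n q0n (ltW pq).
have [d dqr dE] := MVT_on gs.1.1 q0n r0n (ltW qr).
rewrite /diff_quot cE dE !mulfK ?subr_eq0 ?gt_eqF//.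
move: cpq dqr; rewrite !in_itv/= => /andP[pc cq] /andP[qd dr].
apply: Fincr; last exact: le_trans cq qd.
  by rewrite in_itv/= (le_trans ap pc) (le_trans cq (le_trans (ltW qr) rb)).
by rewrite in_itv/= (le_trans ap (le_trans (ltW pq) qd)) (le_trans dr rb).
Qed.

Theorem theorem9 (R : realType) (n : nat) (a b : R) (x beta : nat -> R)
    (B : nat -> R -> R)
    (hn : (1 <= n)%N)
    (hx0 : x 0%N = a) (hxn : x n = b)
    (hx : forall i : nat, (i < n)%N -> x i < x i.+1)
    (hbeta : forall i : nat, (1 <= i <= n)%N -> -1 <= beta i < 0)
    (hB : Bspline_family n x beta B) :
  let Q := quasi_interp n x beta B in
  [/\ (forall p : {poly R}, (size p <= 2)%N ->
         forall t : R, t \in `[a, b] -> Q (fun s => p.[s]) t = p.[t]),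
      op_norm a b Q = 1%:E
    & forall f : R -> R, {within `[a, b], continuous f} ->
      [/\ {in `[a, b] &, {homo f : s t / s <= t}} ->
            {in `[a, b] &, {homo Q f : s t / s <= t}},
          {in `[a, b] &, {homo f : s t /~ s <= t}} ->
            {in `[a, b] &, {homo Q f : s t /~ s <= t}}
        & convex_function `[a, b] f -> convex_function `[a, b] (Q f)]].
Proof.
have adm : admissible n x beta by split.
rewrite -hx0 -hxn /=; split.
- by move=> p p2 t t0n; exact: quasi_interp_affine.
- exact: quasi_interp_norm.
move=> f _; split.
- exact: quasi_interp_increasing.
- move=> fdecr s t s0n t0n ts; rewrite -lerN2 -!quasi_interpN.
  apply: (quasi_interp_increasing adm hB) => // y z y0n z0n yz.
  by rewrite lerN2; exact: fdecr.
- exact: quasi_interp_convex.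
Qed.
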